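(* Let $(S_0,S_1,\dots)$ be a supermartingale relative to a nondecreasing sequence of $\sigma$-algebras $H_{\le0}\subseteq H_{\le1}\subseteq\cdots$, with $S_0\le0$ a.s. and differences $X_i:=S_i-S_{i-1}$. Let $d>0$ and $\sigma_i>0$ ($i=1,2,\dots$) be non-random constants such that $X_i\le d$ and $\operatorname{Var}(X_i\mid H_{\le i-1})\le\sigma_i^2$ a.s. for every $i$. Fix $n\ge1$, let $\sigma^2:=\frac1n(\sigma_1^2+\dots+\sigma_n^2)$ and $h:=d+\sigma^2/d$. Let $T_n:=Z_1+\dots+Z_n$, where $Z_1,\dots,Z_n$ are i.i.d. with $\mathbf{P}(Z_i=d)=\frac{\sigma^2}{d^2+\sigma^2}$ and $\mathbf{P}(Z_i=-\sigma^2/d)=\frac{d^2}{d^2+\sigma^2}$. Then $$\mathbf{P}(S_n\ge y)\le c_2\,\mathbf{P}^{\mathrm{Lin,LC}}\Big(T_n\ge y+\frac h2\Big)\quad\text{for all } y\in\mathbb{R},$$ where $c_2:=e^2/2$.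
   Context: $T_n$ takes values in the lattice $L_{n,d,h}:=\{nd+kh:k\in\mathbb{Z}\}$. The function $y\mapsto\mathbf{P}^{\mathrm{Lin}}(T_n\ge y)$ is the linear interpolation of the tail function $y\mapsto\mathbf{P}(T_n\ge y)$ over $L_{n,d,h}$: $\mathbf{P}^{\mathrm{Lin}}(T_n\ge y)=(1-\gamma)\mathbf{P}(T_n\ge nd+kh)+\gamma\mathbf{P}(T_n\ge nd+(k+1)h)$ whenever $\gamma:=(y-nd-kh)/h\in[0,1]$ for some $k\in\mathbb{Z}$. The function $y\mapsto\mathbf{P}^{\mathrm{Lin,LC}}(T_n\ge y)$ is the least log-concave majorant of $y\mapsto\mathbf{P}^{\mathrm{Lin}}(T_n\ge y)$ on $\mathbb{R}$, i.e. the pointwise smallest function $g:\mathbb{R}\to[0,\infty)$ with $\ln g$ concave (allowing the value $-\infty$) and $g\ge\mathbf{P}^{\mathrm{Lin}}(T_n\ge\cdot)$. *)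

(* Defs.v *)
From HB Require Import structures.
From mathcomp Require Import all_boot all_order all_algebra.
From mathcomp Require Import all_classical all_reals all_analysis measurable_realfun.
Set Implicit Arguments. Unset Strict Implicit. Unset Printing Implicit Defensive.
Import Order.TTheory GRing.Theory Num.Theory.
Local Open Scope classical_set_scope.
Local Open Scope ring_scope.

Section Defs.
Context {R : realType}.

Definition G_measurable {T} {dV} {V : measurableType dV}
  (G : set (set T)) (g : T -> V) : Prop :=
  forall B : set V, measurable B -> G (g @^-1` B).

Definition is_cond_exp {dT} {T : measurableType dT} (P : probability T R)
  (G : set (set T)) (X g : T -> R) : Prop :=
  [/\ G_measurable G g,
      P.-integrable setT (EFin \o g) &
      forall A, G A -> (\int[P]_(x in A) (g x)%:E = \int[P]_(x in A) (X x)%:E)%E].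

Definition is_cond_exp_nneg {dT} {T : measurableType dT} (P : probability T R)
  (G : set (set T)) (Y q : T -> \bar R) : Prop :=
  [/\ @G_measurable T _ (\bar R) G q,
      (forall x, (0 <= q x)%E) &
      forall A, G A -> (\int[P]_(x in A) q x = \int[P]_(x in A) Y x)%E].

Definition Zval (d s2 : R) (b : bool) : R := if b then d else - (s2 / d).
Definition Zprob (d s2 : R) (b : bool) : R :=
  if b then s2 / (d ^+ 2 + s2) else d ^+ 2 / (d ^+ 2 + s2).

(** P(T_n >= y), T_n = Z_1 + ... + Z_n with Z_i i.i.d., computed on the
    canonical product space {ffun 'I_n -> bool}. *)
Definition Ttail (n : nat) (d s2 : R) (y : R) : R :=
  \sum_(z : {ffun 'I_n -> bool} | y <= \sum_(i < n) Zval d s2 (z i))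
     \prod_(i < n) Zprob d s2 (z i).

Definition TtailLin (n : nat) (d s2 h : R) (y : R) : R :=
  let k : int := Num.floor ((y - n%:R * d) / h) in
  let gam := (y - n%:R * d - k%:~R * h) / h in
  (1 - gam) * Ttail n d s2 (n%:R * d + k%:~R * h)
  + gam * Ttail n d s2 (n%:R * d + (k + 1)%:~R * h).

Definition lnE (r : R) : \bar R := if r == 0 then -oo%E else (ln r)%:E.

Definition log_concave (g : R -> R) : Prop :=
  (forall x, 0 <= g x) /\
  forall x y t, 0 <= t <= 1 ->
    (t%:E * lnE (g x) + (1 - t)%R%:E * lnE (g y) <= lnE (g (t * x + (1 - t) * y)%R))%E.

(** Least log-concave majorant: pointwise infimum of all log-concave majorants
    (which is itself the smallest log-concave majorant). *)
Definition least_logconcave_majorant (f : R -> R) (y : R) : R :=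
  inf [set g y | g in [set g : R -> R | log_concave g /\ forall x, f x <= g x]].

Definition TtailLinLC (n : nat) (d s2 h : R) (y : R) : R :=
  least_logconcave_majorant (TtailLin n d s2 h) y.

End Defs.

(* Main.v *)
(* Let X <= d have conditional mean m <= 0 and conditional variance at most v.
   Then X is at most d (X - m) / (d - m), which is centred, bounded by d and of
   conditional second moment at most v; so assume m = 0. For every slope k in
   [0, 1], (X - r)_+ lies below the line e - k (d - X), e = (d - r)_+; squaring,
   and optimising k, bounds E (S + X - t)_+^2 by its value for the two-point
   variable with variance v and values d, -v/d. Iterating bounds E (S_n - t)_+^2
   by the moment of a sum of independent two-point variables, and moving two of
   their variances closer to each other, with fixed sum, increases that moment;
   so it is at most E (T_n - t)_+^2.
   If U is uniform on [-h/2, h/2] and independent of T_n, then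
   E (T_n - t)_+^2 <= E (T_n + U - t)_+^2 by convexity, and T_n + U has the tail
   x |-> P^Lin(T_n >= x + h/2). A log-concave majorant g of P^Lin lies below an
   exponential touching it at y + h/2, of rate l say. If l <= 0 then
   g(y + h/2) >= 1; otherwise E (T_n + U - t)_+^2 is at most
   2 l^-2 e^(l (y - t)) g(y + h/2), and t = y - 2/l in Markov's inequality
   P(S_n >= y) <= E (S_n - t)_+^2 / (y - t)^2 gives the factor e^2/2. *)
Require Import Defs.
From HB Require Import structures.
From mathcomp Require Import all_boot all_order all_algebra.
From mathcomp Require Import all_classical all_reals all_analysis.
From mathcomp Require Import measurable_realfun.
From mathcomp Require Import ring lra.
Set Implicit Arguments.
Unset Strict Implicit.
Unset Printing Implicit Defensive.
Import Order.TTheory GRing.Theory Num.Theory.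
Import numFieldNormedType.Exports.
Local Open Scope classical_set_scope.
Local Open Scope ring_scope.

(** * Averaging the variances *)

Section squared_positive_part.
Context {R : realFieldType}.
Implicit Types c d r u v x y : R.

Definition sqpos x := Num.max x 0 ^+ 2.

Lemma sqpos_ge0 x : 0 <= sqpos x.
Proof. exact: sqr_ge0. Qed.

Lemma ger0_sqpos x : 0 <= x -> sqpos x = x ^+ 2.
Proof. by rewrite /sqpos => /max_idPl ->. Qed.

Lemma ler0_sqpos x : x <= 0 -> sqpos x = 0.
Proof. by rewrite /sqpos => /max_idPr ->; rewrite expr0n. Qed.

Lemma ler_sqpos : {homo sqpos : x y / x <= y}.
Proof.
move=> x y xy; apply: lerXn2r; last exact: le_max2.
all: by rewrite nnegrE le_max lexx orbT.
Qed.

Lemma sqposZ d x : 0 <= d -> sqpos (d * x) = d ^+ 2 * sqpos x.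
Proof. by move=> d0; rewrite /sqpos -exprMn maxr_pMr// mulr0. Qed.

Definition sqneg x := sqpos (- x).

(* With independent B_u, B_v, where B_u = u with probability 1/u and 0
   otherwise, this is E (c - B_u - B_v)_+^2. *)
Definition pair_moment c u v :=
  (1 - u^-1) * (1 - v^-1) * sqpos c + (1 - v^-1) * u^-1 * sqpos (c - u) +
  (1 - u^-1) * v^-1 * sqpos (c - v) + u^-1 * v^-1 * sqpos (c - (u + v)).

Lemma pair_moment_neg c u v : 1 <= u -> 1 <= v -> c <= 0 ->
  pair_moment c u v = 0.
Proof. by move=> u1 v1 c0; rewrite /pair_moment !ler0_sqpos; lra. Qed.

Lemma pair_moment_low c u v : 1 <= u -> 1 <= v -> 0 <= c -> c <= u -> c <= v ->
  pair_moment c u v = c ^+ 2 * (1 - (u + v - 1) / (u * v)).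
Proof.
move=> u1 v1 c0 cu cv; rewrite /pair_moment ger0_sqpos ?ler0_sqpos; try lra.
by field; apply/andP; split; lra.
Qed.

Lemma pair_moment_mid c u v : 1 <= u -> 1 <= v -> u <= c -> c <= v ->
  pair_moment c u v = (1 - v^-1) * (c ^+ 2 - c *+ 2 + u).
Proof.
move=> u1 v1 uc cv; rewrite /pair_moment 2?ger0_sqpos ?ler0_sqpos; try lra.
by field; apply/andP; split; lra.
Qed.

Lemma pair_moment_high c u v : 1 <= u -> 1 <= v -> u <= c -> v <= c ->
    c <= u + v ->
  pair_moment c u v =
  c ^+ 2 - c *+ 4 + (u + v) + 2 - (u + v - c) ^+ 2 / (u * v).
Proof.
move=> u1 v1 uc vc cuv; rewrite /pair_moment 3?ger0_sqpos ?ler0_sqpos; try lra.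
by field; apply/andP; split; lra.
Qed.

Lemma pair_moment_top c u v : 1 <= u -> 1 <= v -> u + v <= c ->
  pair_moment c u v = c ^+ 2 - c *+ 4 + (u + v) + 2.
Proof.
move=> u1 v1 uvc; rewrite /pair_moment !ger0_sqpos; try lra.
by field; apply/andP; split; lra.
Qed.

Lemma mulr_le_of_closer u v u' v' : u + v = u' + v' -> u <= u' -> u' <= v' ->
  u * v <= u' * v'.
Proof.
move=> uvE uu' u'v'; have -> : v = u' + v' - u by lra.
rewrite -subr_ge0 (_ : _ - _ = (u' - u) * (v' - u)); last by ring.
by apply: mulr_ge0; lra.
Qed.

Lemma pair_moment_low_le c u v u' v' : 1 <= u -> u <= u' -> u' <= v' ->
    u + v = u' + v' -> 0 <= c -> c <= u ->
  pair_moment c u v <= pair_moment c u' v'.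
Proof.
move=> u1 uu' u'v' uvE c0 cu; rewrite !pair_moment_low; try lra.
apply: ler_wpM2l; first exact: sqr_ge0.
rewrite lerD2l lerN2 uvE; apply: ler_wpM2l; first lra.
rewrite lef_pV2 ?posrE; [|apply: mulr_gt0; lra..].
exact: mulr_le_of_closer.
Qed.

Lemma pair_moment_mid_le c u v u' v' : 1 <= u -> u <= u' -> u' <= v' ->
    u + v = u' + v' -> u' <= c -> c <= v' ->
  pair_moment c u v <= pair_moment c u' v'.
Proof.
move=> u1 uu' u'v' uvE u'c cv'; rewrite !pair_moment_mid; try lra.
rewrite -subr_ge0.
have -> : (1 - v'^-1) * (c ^+ 2 - c *+ 2 + u') -
    (1 - v^-1) * (c ^+ 2 - c *+ 2 + u) =
    (u' - u) * ((v' - c) * (v - 1) + c * (v - c) + (c - u')) / (v * v').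
  have -> : v = u' + v' - u by lra.
  by field; apply/andP; split; lra.
apply: divr_ge0; apply: mulr_ge0; try lra.
by apply: addr_ge0; [apply: addr_ge0; apply: mulr_ge0|]; lra.
Qed.

Lemma pair_moment_high_le c u v u' v' : 1 <= u -> u <= u' -> u' <= v' ->
    u + v = u' + v' -> v <= c -> c <= u + v ->
  pair_moment c u v <= pair_moment c u' v'.
Proof.
move=> u1 uu' u'v' uvE vc cuv; rewrite !pair_moment_high; try lra.
rewrite uvE lerD2l lerN2; apply: ler_wpM2l; first exact: sqr_ge0.
rewrite lef_pV2 ?posrE; [|apply: mulr_gt0; lra..].
exact: mulr_le_of_closer.
Qed.

(* Moving u and v towards each other, stop whenever one of them meets c: each
   leg of the motion then stays within one of the ranges above. *)
Lemma pair_moment_le c u v u' v' : 1 <= u -> u <= u' -> u' <= v' ->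
  u + v = u' + v' -> pair_moment c u v <= pair_moment c u' v'.
Proof.
move=> u1 uu' u'v' uvE.
have [c0|c0] := leP c 0; first by rewrite !pair_moment_neg; lra.
have [cu|cu] := leP c u; first by apply: pair_moment_low_le; lra.
have [cu'|cu'] := leP c u'.
  apply: (@le_trans _ _ (pair_moment c c (u + v - c))).
    by apply: pair_moment_mid_le; lra.
  by apply: pair_moment_low_le; lra.
have [cv'|cv'] := leP c v'; first by apply: pair_moment_mid_le; lra.
have [cv|cv] := leP c v.
  apply: (@le_trans _ _ (pair_moment c (u + v - c) c)).
    by apply: pair_moment_mid_le; lra.
  by apply: pair_moment_high_le; lra.
have [cuv|cuv] := leP c (u + v); first by apply: pair_moment_high_le; lra.
by rewrite !pair_moment_top; lra.
Qed.

End squared_positive_part.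

Lemma foldr_perm (T : eqType) (S : Type) (op : T -> S -> S) (x : S)
    (s1 s2 : seq T) :
  left_commutative op -> perm_eq s1 s2 -> foldr op x s1 = foldr op x s2.
Proof.
move=> opCA; elim: s1 s2 => [|y s1 IH] s2 s12.
  by move: s12; rewrite perm_sym => /perm_nilP ->.
have ys2 : y \in s2 by rewrite -(perm_mem s12) mem_head.
case/splitPr: ys2 s12 => p1 p2; rewrite -cat1s perm_sym -(cat1s y p2).
rewrite perm_catCA perm_cat2l perm_sym.
move=> /IH /= ->; elim: p1 => //= z p1 <-; exact: opCA.
Qed.

Section mean_of_sequence.
Context {R : realFieldType}.
Implicit Types (us vs : seq R) (a b w : R).

Lemma has_le_mean us w : us != [::] ->
  \sum_(u <- us) u <= (size us)%:R * w -> has (<= w) us.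
Proof.
move=> us0; apply: contraTT => /hasPn uw; rewrite -ltNge mulr_natl -iter_addr_0.
rewrite -count_predT -big_const_seq; case: us us0 uw => // u us _ uw.
rewrite !big_cons; apply: ltr_leD; first by rewrite ltNge uw ?mem_head.
rewrite big_seq [leRHS]big_seq; apply: ler_sum => v vus.
by rewrite ltW// ltNge uw// inE vus orbT.
Qed.

Lemma has_ge_mean us w : us != [::] ->
  (size us)%:R * w <= \sum_(u <- us) u -> has (>= w) us.
Proof.
move=> us0 sum_ge.
have /hasP[_ /mapP[b bus ->] bw] : has (<= - w) (map -%R us).
  apply: has_le_mean; first by case: us us0 {sum_ge}.
  by rewrite big_map sumrN size_map mulrN lerN2.
by apply/hasP; exists b => //; rewrite -lerN2.
Qed.

Lemma perm_straddling_mean us w : (1 < size us)%N ->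
  \sum_(u <- us) u = (size us)%:R * w ->
  exists a b vs, perm_eq us [:: a, b & vs] /\ a <= w <= b.
Proof.
move=> us1 sum_us; have us0 : us != [::] by case: us us1 {sum_us}.
have /hasP[a aus aw] : has (<= w) us by apply: has_le_mean; rewrite ?sum_us.
have us_a := perm_to_rem aus; set us' := rem a us in us_a.
have size_us : size us = (size us').+1 by rewrite (perm_size us_a).
have /hasP[b bus wb] : has (>= w) us'.
  apply: has_ge_mean; first by rewrite -size_eq0 -lt0n -ltnS -size_us.
  move: sum_us; rewrite size_us (perm_big _ us_a) big_cons -natr1 mulrDl mul1r.
  by move: aw => /=; lra.
exists a, b, (rem b us'); split; last exact/andP.
by rewrite (perm_trans us_a)// perm_cons perm_to_rem.
Qed.

End mean_of_sequence.

Section two_point_averages.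
Context {R : realType}.
Implicit Types (d t v w : R) (V : R -> R) (vs : seq R).

Lemma Zprob_ge0 d v b : 0 <= v -> 0 <= Zprob d v b.
Proof. by case: b => v0; rewrite divr_ge0 ?addr_ge0 ?sqr_ge0. Qed.

Definition two_point d v V t := \sum_b Zprob d v b * V (t - Zval d v b).

Lemma two_point_le d v V W t : 0 <= v -> (forall t, V t <= W t) ->
  two_point d v V t <= two_point d v W t.
Proof.
by move=> v0 VW; apply: ler_sum => b _; apply: ler_wpM2l; rewrite ?Zprob_ge0.
Qed.

Lemma two_pointCA d : left_commutative (two_point d).
Proof.
move=> v w V; apply/funext => t; rewrite /two_point.
under eq_bigr do rewrite mulr_sumr; rewrite exchange_big /=.
apply: eq_bigr => b _; rewrite mulr_sumr; apply: eq_bigr => c _.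
by rewrite mulrCA addrAC.
Qed.

Definition two_points d vs V := foldr (two_point d) V vs.

Lemma two_points_le d vs V W t : all (>= 0) vs ->
  (forall t, V t <= W t) -> two_points d vs V t <= two_points d vs W t.
Proof.
move=> + VW; elim: vs t => //= v vs IH t /andP[v0 vs0].
by apply: two_point_le => // ?; exact: IH.
Qed.

Lemma perm_two_points d vs ws V : perm_eq vs ws ->
  two_points d vs V = two_points d ws V.
Proof. by apply: foldr_perm; exact: two_pointCA. Qed.

Lemma two_point_pair d v w t : 0 < d -> 0 <= v -> 0 <= w ->
  two_point d v (two_point d w sqneg) t =
  d ^+ 2 * pair_moment ((2 * d - t) / d) (1 + v / d ^+ 2) (1 + w / d ^+ 2).
Proof.
move=> d0 v0 w0; have dd0 : 0 < d ^+ 2 by rewrite exprn_gt0.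
have scale x y : y = d * x -> sqpos y = d ^+ 2 * sqpos x.
  by move=> ->; rewrite sqposZ// ltW.
rewrite /two_point !big_bool /= /sqneg /pair_moment; set c := (2 * d - t) / d.
rewrite (scale c); last by rewrite /c; field; lra.
rewrite (scale (c - (1 + w / d ^+ 2)) (- (t - d - - (w / d)))); last first.
  by rewrite /c; field; lra.
rewrite (scale (c - (1 + v / d ^+ 2)) (- (t - - (v / d) - d))); last first.
  by rewrite /c; field; lra.
rewrite (scale (c - (1 + v / d ^+ 2 + (1 + w / d ^+ 2)))
  (- (t - - (v / d) - - (w / d)))); last by rewrite /c; field; lra.
by field; apply/and3P; split; lra.
Qed.

Lemma two_point_pair_le d a b v w t : 0 < d -> 0 <= a -> a <= v -> a <= w ->
    a + b = v + w ->
  two_point d a (two_point d b sqneg) t <=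
  two_point d v (two_point d w sqneg) t.
Proof.
move=> d0 a0 av aw abE; wlog vw : v w av aw abE / v <= w.
  move=> ordered; have [|/ltW wv] := leP v w; first exact: ordered.
  by rewrite (two_pointCA d v); apply: ordered => //; rewrite abE addrC.
have dd0 : 0 <= (d ^+ 2)^-1 by rewrite invr_ge0 sqr_ge0.
rewrite !two_point_pair; try lra; apply: ler_wpM2l; first exact: sqr_ge0.
apply: pair_moment_le; first by rewrite lerDl mulr_ge0.
- by rewrite lerD2l ler_wpM2r.
- by rewrite lerD2l ler_wpM2r.
- by rewrite addrACA -mulrDl abE mulrDl addrACA.
Qed.

Lemma two_points_transfer d a b vs w t : 0 < d ->
    0 <= a -> a <= w <= b -> all (>= 0) vs ->
  two_points d [:: a, b & vs] sqneg t <=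
  two_points d [:: w, a + b - w & vs] sqneg t.
Proof.
move=> d0 a0 awb vs0.
have inside x y : two_points d [:: x, y & vs] sqneg =
    two_points d vs (two_point d x (two_point d y sqneg)).
  rewrite (@perm_two_points _ _ (vs ++ [:: x; y])); last first.
    by rewrite perm_sym perm_catC.
  by rewrite /two_points foldr_cat.
case/andP: awb => aw wb; rewrite !inside; apply: two_points_le => // ?.
by apply: two_point_pair_le; lra.
Qed.

(* Each transfer makes one more variance equal to the mean. *)
Lemma two_points_le_mean d vs w t : 0 < d -> all (>= 0) vs ->
    \sum_(v <- vs) v = (size vs)%:R * w ->
  two_points d vs sqneg t <= two_points d (nseq (size vs) w) sqneg t.
Proof.
move=> d0; move size_vs : (size vs) => n.
elim: n vs t size_vs => [|n IH] vs t size_vs vs0 sum_vs.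
  by rewrite (size0nil size_vs).
case: n => [|n] in IH size_vs sum_vs *.
  case: vs size_vs sum_vs {vs0} => [|v []]//= _.
  by rewrite big_seq1 mul1r => ->.
have [||a [b [us [vsE awb]]]] := @perm_straddling_mean _ vs w;
  rewrite ?size_vs//.
have /and3P[/= a0 /= b0 us0] : all (>= 0) [:: a, b & us].
  by rewrite -(perm_all _ vsE).
have [aw wb] := andP awb.
rewrite (perm_two_points _ _ vsE).
apply: le_trans (two_points_transfer _ _ _ awb _) _ => //=.
apply: two_point_le => [|s]; first exact: le_trans aw.
have size_us : size us = n by move: (perm_size vsE); rewrite size_vs => -[].
apply: (IH (a + b - w :: us)); first by rewrite /= size_us.
  by apply/andP; split=> //=; lra.
move: sum_vs; rewrite (perm_big _ vsE) !big_cons -(natr1 n.+1) mulrDl mul1r /=.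
by lra.
Qed.

End two_point_averages.

Section ffun_cons.
Context {B : finType} {V : nmodType} {n : nat}.

Definition ffun_cons (b : B) (f : {ffun 'I_n -> B}) : {ffun 'I_n.+1 -> B} :=
  [ffun i => if unlift ord0 i is Some j then f j else b].

Lemma sum_ffun_cons (F : {ffun 'I_n.+1 -> B} -> V) :
  \sum_z F z = \sum_b \sum_f F (ffun_cons b f).
Proof.
rewrite pair_big /= (reindex (fun q : B * _ => ffun_cons q.1 q.2)) //.
exists (fun z : {ffun 'I_n.+1 -> B} => (z ord0, [ffun j => z (lift ord0 j)])).
  move=> [b f] _ /=; congr (_, _); first by rewrite ffunE unlift_none.
  by apply/ffunP => j; rewrite !ffunE liftK.
move=> z _; apply/ffunP => i; rewrite ffunE /=.
by case: unliftP => [j|] ->; rewrite ?ffunE.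
Qed.

End ffun_cons.

Section binomial_expectation.
Context {R : realType}.
Implicit Types (c d t v w x : R) (V F : R -> R) (vs : seq R) (n : nat).

Definition Tprob n d v (z : {ffun 'I_n -> bool}) :=
  \prod_(i < n) Zprob d v (z i).

Definition Tval n d v (z : {ffun 'I_n -> bool}) := \sum_(i < n) Zval d v (z i).

Definition Texpect n d v F :=
  \sum_(z : {ffun 'I_n -> bool}) Tprob d v z * F (Tval d v z).

Lemma Zprob_gt0 d v b : 0 < d -> 0 < v -> 0 < Zprob d v b.
Proof.
by move=> d0 v0; case: b; rewrite divr_gt0 ?addr_gt0 ?exprn_gt0.
Qed.

Lemma Tprob_gt0 n d v (z : {ffun 'I_n -> bool}) :
  0 < d -> 0 < v -> 0 < Tprob d v z.
Proof. by move=> d0 v0; apply: prodr_gt0 => i _; exact: Zprob_gt0. Qed.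

Lemma Texpect_cst n d v c : 0 < d -> 0 < v -> Texpect n d v (fun=> c) = c.
Proof.
move=> d0 v0; rewrite /Texpect -mulr_suml.
rewrite -(bigA_distr_bigA (fun _ => Zprob d v)) /= big1 ?mul1r// => i _.
by rewrite big_bool /= -mulrDl addrC divff// gt_eqF// addr_gt0// exprn_gt0.
Qed.

Lemma Texpect_le n d v F F' : 0 < d -> 0 < v ->
  (forall x, F x <= F' x) -> Texpect n d v F <= Texpect n d v F'.
Proof.
by move=> d0 v0 FF'; apply: ler_sum => z _; rewrite ler_wpM2l// ltW// Tprob_gt0.
Qed.

Lemma two_points_Texpect n d v V t :
  two_points d (nseq n v) V t = Texpect n d v (fun s => V (t - s)).
Proof.
elim: n t => [|n IH] t.
  rewrite /Texpect (bigD1 [ffun=> true])//= big1 ?addr0; last first.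
    by move=> z /eqP []; apply/ffunP => -[].
  by rewrite /Tprob /Tval !big_ord0 mul1r subr0.
rewrite -[LHS]/(two_point d v (two_points d (nseq n v) V) t).
rewrite /Texpect sum_ffun_cons.
apply: eq_bigr => b _; rewrite IH /Texpect mulr_sumr.
apply: eq_bigr => f _; rewrite /Tprob /Tval !big_ord_recl !ffunE unlift_none.
rewrite mulrA opprD addrA.
by congr (_ * _ * V (_ - _)); apply: eq_bigr => i _; rewrite ffunE liftK.
Qed.

Lemma two_points_le_Texpect d vs w t : 0 < d -> all (>= 0) vs ->
    \sum_(v <- vs) v = (size vs)%:R * w ->
  two_points d vs sqneg t <=
  Texpect (size vs) d w (fun s => sqpos (s - t)).
Proof.
move=> d0 vs0 sum_vs.
suff <- : two_points d (nseq (size vs) w) sqneg t =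
    Texpect (size vs) d w (fun s => sqpos (s - t)) by exact: two_points_le_mean.
by rewrite two_points_Texpect; apply: eq_bigr => z _; rewrite /sqneg opprB.
Qed.

End binomial_expectation.

(** * Conditionally nonpositive variables *)

Section sigma_algebra_measurability.
Context {dT : measure_display} {T : measurableType dT} (G : set (set T)).

Lemma sigma_algebra_setT : sigma_algebra setT G -> G setT.
Proof. by case=> G0 GC _; rewrite -(setD0 setT); exact: GC. Qed.

Lemma sigma_algebra_setI A B :
  sigma_algebra setT G -> G A -> G B -> G (A `&` B).
Proof.
by move/sigma_algebra_id <-; exact: (@measurableI _ (g_sigma_algebraType G)).
Qed.

Lemma G_measurable_fun dV (V : measurableType dV) (f : T -> V) :
  G `<=` measurable -> G_measurable G f -> measurable_fun setT f.
Proof. by move=> Gm Gf _ B mB; rewrite setTI; apply: Gm; exact: Gf. Qed.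

Lemma G_measurable_comp dU dV (U : measurableType dU) (V : measurableType dV)
    (f : T -> U) (g : U -> V) :
  measurable_fun setT g -> G_measurable G f -> G_measurable G (g \o f).
Proof.
move=> mg Gf B mB; rewrite comp_preimage; apply: Gf.
by rewrite -[X in measurable X]setTI; exact: mg.
Qed.

Lemma G_measurable_ge (R : realType) (f : T -> R) (a : R) :
  G_measurable G f -> G [set x | a <= f x].
Proof.
move=> Gf; have -> : [set x | a <= f x] = f @^-1` `[a, +oo[.
  by apply/seteqP; split=> x /=; rewrite in_itv/= andbT.
by apply: Gf; exact: measurable_itv.
Qed.

End sigma_algebra_measurability.

Lemma truncn_sum_layers (R : archiRealFieldType) (x : R) (n : nat) :
  x <= n%:R -> (Num.truncn x)%:R = \sum_(i < n) (i.+1%:R <= x)%R%:R :> R.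
Proof.
move=> xn; have le_n : (Num.truncn x <= n)%N.
  by rewrite truncn_le_nat (le_lt_trans xn)// ltr_nat.
rewrite -[in LHS](card_ord (Num.truncn x)) -sumr_const.
rewrite (big_ord_widen _ (fun=> 1) le_n) big_mkcond; apply: eq_bigr => i _.
by rewrite truncn_gt_nat; case: ifP.
Qed.

Lemma natmul_bounded_le0 (R : archiRealFieldType) (x c : R) :
  (forall n, n%:R * x <= c) -> x <= 0.
Proof.
move=> x_bounded; rewrite leNgt; apply/negP => x0.
have := x_bounded (Num.truncn (c / x)).+1.
by rewrite leNgt -ltr_pdivrMr// truncnS_gt.
Qed.

Lemma bounded_between (R : realFieldType) (T : Type) (f : T -> R) (a b : R) :
  (forall x, a <= f x <= b) -> [bounded f x | x in setT].
Proof.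
move=> abf; exists (Num.max `|a| `|b|).
split=> [|M abM x _]; first exact: num_real.
have /andP[af fb] := abf x; rewrite /= ler_norml.
move: abM; rewrite gt_max => /andP[aM bM].
rewrite lerNl (le_trans _ (ltW aM)); last by rewrite ler_normr lerN2 af orbT.
by rewrite (le_trans fb)// (le_trans (ler_norm _))// ltW.
Qed.

Lemma integrable_bounded (R : realType) (dT : measure_display)
    (T : measurableType dT) (mu : {finite_measure set T -> \bar R}) (f : T -> R)
    (a b : R) : measurable_fun setT f -> (forall x, a <= f x <= b) ->
  mu.-integrable setT (EFin \o f).
Proof.
move=> mf abf; apply: measurable_bounded_integrable => //.
  by rewrite -ge0_fin_numE// fin_num_measure.
exact: bounded_between abf.
Qed.

Section conditionally_nonpositive.
Context {R : realType} {dT : measure_display} {T : measurableType dT}.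
Variables (mu : {measure set T -> \bar R}) (G : set (set T)).
Implicit Types (A : set T) (Y w : T -> R).

(* This says that E(Y | G) <= 0 almost surely. *)
Definition cond_nonpos Y := mu.-integrable setT (EFin \o Y) /\
  forall A, G A -> (\int[mu]_(x in A) (Y x)%:E <= 0)%E.

Hypotheses (sG : sigma_algebra setT G) (Gm : G `<=` measurable).

Lemma cond_nonposD Y Z : cond_nonpos Y -> cond_nonpos Z -> cond_nonpos (Y \+ Z).
Proof.
move=> [iY Y0] [iZ Z0].
split=> [|A GA]; first exact: (integrableD measurableT iY iZ).
have mA := Gm GA; have iA W (iW : mu.-integrable setT (EFin \o W)) :
  mu.-integrable A (EFin \o W) by exact: (integrableS _ _ _ iW).
rewrite (_ : integral _ _ _ = \int[mu]_(x in A) (Y x)%:E +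
  \int[mu]_(x in A) (Z x)%:E)%E; last by apply: integralD_EFin => //; exact: iA.
by rewrite adde_le0 ?Y0 ?Z0.
Qed.

Lemma ae_le0_cond_nonpos Y : mu.-integrable setT (EFin \o Y) ->
  {ae mu, forall x, Y x <= 0} -> cond_nonpos Y.
Proof.
move=> iY Y0; split=> // A GA; have mA := Gm GA.
have mY : measurable_fun A (EFin \o Y).
  by apply: measurable_funS (measurable_int _ iY).
rewrite (ae_eq_integral (fun x => - (Num.max (- Y x) 0)%:E)%E) => //.
- rewrite integral_ge0N ?oppe_le0 ?integral_ge0// => x _;
    by rewrite lee_fin le_max lexx orbT.
- apply/measurable_EFinP/measurable_funN/measurable_maxr => //.
  by apply/measurable_funN/measurable_EFinP.
- by apply: filterS Y0 => x Y0 _ /=; rewrite max_l ?opprK// oppr_ge0.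
Qed.

Lemma cond_nonpos_ae_le0 Y : G_measurable G Y -> cond_nonpos Y ->
  {ae mu, forall x, Y x <= 0}.
Proof.
move=> GY [iY Y0]; pose A := [set x | 0 < Y x].
have GA : G A.
  have -> : A = Y @^-1` `]0, +oo[.
    by apply/seteqP; split=> x /=; rewrite in_itv/= andbT.
  by apply: GY; exact: measurable_itv.
have mA := Gm GA; have iYA := integrableS measurableT mA (@subsetT _ _) iY.
have /(ae_eq_integral_abs _ mA (measurable_int _ iYA)) :
    (\int[mu]_(x in A) `|(EFin \o Y) x| = 0)%E.
  apply/eqP; rewrite eq_le; apply/andP; split; last by apply: integral_ge0.
  rewrite (eq_integral (EFin \o Y)); first exact: Y0.
  by move=> x /set_mem /ltW Yx; rewrite /= ger0_norm.
apply: filterS => x /= Yx0; rewrite leNgt; apply/negP => Yx.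
by have [e] := Yx0 Yx; rewrite e ltxx in Yx.
Qed.

(* Replacing w by its integer part costs at most |Y|, and the integer part is a
   sum of indicators of sets in G. *)
Lemma cond_nonpos_mul_le_norm Y w A (n : nat) : cond_nonpos Y ->
    G_measurable G w -> (forall x, 0 <= w x <= n%:R) ->
    mu.-integrable setT (EFin \o (w \* Y)) -> G A ->
  (\int[mu]_(x in A) (w x * Y x)%:E <= \int[mu]_(x in A) `|Y x|%:E)%E.
Proof.
move=> [iY Y0] Gw w_n iwY GA; have mA := Gm GA.
pose layer (i : 'I_n) := [set x | i.+1%:R <= w x].
have Glayer i : G (A `&` layer i).
  by apply: sigma_algebra_setI => //; exact: G_measurable_ge.
have iYA : mu.-integrable A (EFin \o Y) by exact: (integrableS _ _ _ iY).
have inY : mu.-integrable A (EFin \o (Num.norm \o Y)) by exact: integrable_norm.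
have i_layer i : mu.-integrable A ((EFin \o Y) \_ (layer i)).
  apply/integrable_restrict => //; first exact: (Gm (G_measurable_ge _ Gw)).
  exact: (integrableS _ (Gm (Glayer i)) _ iY).
have i_sum :
    mu.-integrable A (fun x => \sum_(i < n) ((EFin \o Y) \_ (layer i)) x)%E.
  exact: integrable_sum.
have sumE x : (\sum_(i < n) ((EFin \o Y) \_ (layer i)) x =
    ((Num.truncn (w x))%:R * Y x)%:E)%E.
  have /andP[_ wn] := w_n x.
  rewrite (truncn_sum_layers wn) big_distrl /= -sumEFin; apply: eq_bigr => i _.
  rewrite patchE (_ : (x \in layer i) = (i.+1%:R <= w x)).
    by case: ifP; rewrite ?mul1r ?mul0r.
  by apply/idP/idP => [/set_mem|] // ?; exact/mem_set.
apply: (@le_trans _ _ (\int[mu]_(x in A)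
    (\sum_(i < n) ((EFin \o Y) \_ (layer i)) x + `|Y x|%:E))%E).
  apply: le_integral => //; first exact: (integrableS _ _ _ iwY).
    exact: integrableD.
  move=> x _; rewrite sumE lee_fin -lerBlDl -mulrBl (le_trans (ler_norm _))//.
  have /andP[w0 _] := w_n x; have /andP[le_w w_lt] := truncn_itv w0.
  rewrite normrM ler_piMl// ger0_norm ?subr_ge0// lerBlDr.
  by rewrite addrC natr1 ltW.
rewrite integralD// integral_sum//; apply: geeDr; apply: sume_le0 => i _.
by rewrite -integral_mkcondr; exact: Y0.
Qed.

Lemma cond_nonposM Y w (M : R) : G_measurable G w ->
  (forall x, 0 <= w x <= M) -> cond_nonpos Y -> cond_nonpos (w \* Y).
Proof.
move=> Gw w_M cY; have [iY _] := cY.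
have i_mul (u : T -> R) : G_measurable G u -> [bounded u x | x in setT] ->
    mu.-integrable setT (EFin \o (u \* Y)).
  move=> Gu bu; have measurable_u := G_measurable_fun Gm Gu.
  exact: (integrableMr measurableT measurable_u bu iY).
have iwY := i_mul _ Gw (bounded_between w_M); split=> // A GA.
have mA := Gm GA; have iwYA := integrableS measurableT mA (@subsetT _ _) iwY.
have inY : mu.-integrable A (EFin \o (Num.norm \o Y)).
  by apply: integrable_norm; exact: (integrableS _ _ _ iY).
rewrite -(fineK (integrable_fin_num _ iwYA))// lee_fin.
apply: (@natmul_bounded_le0 _ _ (fine (\int[mu]_(x in A) `|Y x|%:E))) => n.
rewrite -lee_fin EFinM !fineK; [|exact: integrable_fin_num..].
rewrite -integralZl//.
rewrite (eq_integral (fun x => (n%:R * w x * Y x)%:E)) => [|x _]; last first.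
  by rewrite /= -EFinM mulrA.
have Gnw : G_measurable G (fun x => n%:R * w x).
  exact: (G_measurable_comp (mulrl_measurable n%:R) Gw).
have nw_le x : 0 <= n%:R * w x <= (Num.truncn (n%:R * M)).+1%:R.
  have /andP[w0 wM] := w_M x; rewrite mulr_ge0//=.
  by rewrite (le_trans _ (ltW (truncnS_gt _)))// ler_wpM2l.
apply: (cond_nonpos_mul_le_norm cY Gnw nw_le _ GA).
by apply: i_mul => //; exact: bounded_between nw_le.
Qed.

End conditionally_nonpositive.

(** * One step of the supermartingale *)

Section shrink_and_slope.
Context {R : realType}.
Implicit Types d e r s t v x y B : R.

Definition shrink d s := d / (d - Num.min s 0).

Lemma shrink_itv d s : 0 < d -> 0 <= shrink d s <= 1.
Proof.
move=> d0; have s0 : Num.min s 0 <= 0 by rewrite ge_min lexx orbT.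
by rewrite /shrink divr_ge0 ?ler_pdivrMr; lra.
Qed.

Lemma measurable_shrink d : 0 < d -> measurable_fun setT (shrink d).
Proof.
move=> d0; apply: nondecreasing_measurable => // x y xy.
have min0 (s : R) : Num.min s 0 <= 0 by rewrite ge_min lexx orbT.
apply: ler_wpM2l; first exact: ltW.
rewrite lef_pV2 ?posrE; [|have := min0 x; lra|have := min0 y; lra].
by rewrite lerD2l lerN2; apply: le_min2.
Qed.

Lemma shrink_centred_bounds d s x : 0 < d -> s <= 0 -> x <= d ->
  x <= shrink d s * (x - s) <= d.
Proof.
move=> d0 s0 xd; rewrite /shrink (min_idPl s0) mulrAC; apply/andP; split.
  rewrite ler_pdivlMr; last lra.
  rewrite -subr_ge0 (_ : _ - _ = - s * (d - x)); last by ring.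
  by apply: mulr_ge0; lra.
by rewrite ler_pdivrMr ?ler_wpM2l ?(ltW d0); lra.
Qed.

(* The k in [0, 1] that minimises E (e - k (d - X))^2 for X centred with
   variance v. *)
Definition slope d v e := Num.min 1 (e * d / (d ^+ 2 + v)).

Lemma slope_itv d v e : 0 < d -> 0 <= v -> 0 <= e -> 0 <= slope d v e <= 1.
Proof.
move=> d0 v0 e0; rewrite /slope ge_min lexx le_min ler01 /= andbT.
by rewrite divr_ge0// ?mulr_ge0// ?addr_ge0 ?sqr_ge0// ltW.
Qed.

Lemma measurable_slope d v : measurable_fun setT (slope d v).
Proof.
apply: measurable_minr => //.
by apply: measurable_funM => //; apply: measurable_funM.
Qed.

Definition intercept d v e := e - slope d v e * d.

Lemma intercept_itv d v e : 0 < d -> 0 <= v -> 0 <= e ->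
  0 <= intercept d v e <= e.
Proof.
move=> d0 v0 e0; have D0 : 0 < d ^+ 2 + v by rewrite ltr_wpDr ?exprn_gt0.
have /andP[k0 _] := slope_itv d0 v0 e0.
rewrite gerBl mulr_ge0 ?(ltW d0)// andbT subr_ge0.
apply: (@le_trans _ _ (e * d / (d ^+ 2 + v) * d)).
  by rewrite ler_wpM2r ?(ltW d0)// /slope ge_min lexx orbT.
rewrite mulrAC ler_pdivrMr// -mulrA; apply: ler_wpM2l => //.
by rewrite -expr2 lerDl.
Qed.

Lemma measurable_intercept d v : measurable_fun setT (intercept d v).
Proof.
apply: measurable_funB => //; apply: measurable_funM => //.
exact: measurable_slope.
Qed.

Lemma slope_two_point d v s t : 0 < d -> 0 <= v ->
  let e := Num.max 0 (s + d - t) in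
  intercept d v e ^+ 2 + slope d v e ^+ 2 * v =
  two_point d v (fun t => sqpos (s - t)) t.
Proof.
move=> d0 v0 e; have D0 : 0 < d ^+ 2 + v by rewrite ltr_wpDr ?exprn_gt0.
have vd0 : 0 <= v / d by rewrite divr_ge0// ltW.
rewrite /two_point big_bool /=; have [e0|e0] := leP (s + d - t) 0.
  have -> : e = 0 by rewrite /e max_l.
  rewrite /intercept /slope !mul0r min_r ?ler01// !ler0_sqpos; [ring|lra..].
have eE : e = s + d - t by rewrite /e max_r ?ltW.
rewrite (_ : s - (t - d) = e); last by rewrite eE; ring.
rewrite (_ : s - (t - - (v / d)) = e - (d ^+ 2 + v) / d); last first.
  by rewrite eE; field; lra.
rewrite ger0_sqpos; last by rewrite eE ltW.
rewrite /intercept /slope; have [k1|k1] := leP 1 (e * d / (d ^+ 2 + v)).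
  move: k1; rewrite ler_pdivlMr// mul1r => k1.
  rewrite ger0_sqpos ?subr_ge0 ?ler_pdivrMr//.
  by field; apply/andP; split; lra.
move: k1; rewrite ltr_pdivrMr// mul1r => /ltW k1.
rewrite ler0_sqpos ?subr_le0 ?ler_pdivlMr//.
by field; lra.
Qed.

Lemma sqpos_le_sqr_line d v e x r : 0 < d -> 0 <= v -> 0 <= e -> x <= d ->
  d - r <= e -> sqpos (x - r) <= (intercept d v e + slope d v e * x) ^+ 2.
Proof.
move=> d0 v0 e0 xd dre; have [xr|xr] := leP (x - r) 0.
  by rewrite ler0_sqpos// sqr_ge0.
have /andP[k0 k1] := slope_itv d0 v0 e0.
have kdx : slope d v e * (d - x) <= d - x by rewrite ler_piMl; lra.
have -> : intercept d v e + slope d v e * x = e - slope d v e * (d - x).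
  by rewrite /intercept; ring.
by rewrite ger0_sqpos ?ler_sqr ?nnegrE; lra.
Qed.

Definition clipped_excess d t B s :=
  Num.max 0 (Num.min (s + d - t) (B + d - t)).

Lemma clipped_excess_itv d t B s :
  0 <= clipped_excess d t B s <= Num.max 0 (B + d - t).
Proof. by rewrite le_max lexx le_max2 ?ge_min ?lexx ?orbT. Qed.

Lemma clipped_excessE d t B s : s <= B ->
  clipped_excess d t B s = Num.max 0 (s + d - t).
Proof. by move=> sB; congr (Num.max 0 _); apply/min_idPl; lra. Qed.

Lemma measurable_clipped_excess d t B :
  measurable_fun setT (clipped_excess d t B).
Proof.
apply: measurable_maxr => //; apply: measurable_minr => //.
by apply: measurable_funB => //; exact: measurable_funD.
Qed.

End shrink_and_slope.

Section dominated_step.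
Context {R : realType} {dT : measure_display} {T : measurableType dT}.
Variables (P : probability T R) (G : set (set T)).
Implicit Types (S X Y m w : T -> R) (q : T -> \bar R) (d v : R).

Definition dominated_step d v S S' := exists X : T -> R,
  [/\ {ae P, forall x, S' x <= S x + X x}, {ae P, forall x, X x <= d},
      cond_nonpos P G X & cond_nonpos P G (fun x => X x ^+ 2 - v)].

Hypotheses (sG : sigma_algebra setT G) (Gm : G `<=` measurable).

Lemma is_cond_exp_cond_nonpos X m :
  is_cond_exp P G X m -> cond_nonpos P G X -> cond_nonpos P G m.
Proof. by move=> [_ im mE] [_ X0]; split=> // A GA; rewrite mE// X0. Qed.

Lemma cond_nonpos_centred X m : P.-integrable setT (EFin \o X) ->
  is_cond_exp P G X m -> cond_nonpos P G (X \- m).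
Proof.
move=> iX [_ im mE].
split=> [|A GA]; first exact: (integrableB measurableT iX im).
have mA := Gm GA.
have iA Y (iY : P.-integrable setT (EFin \o Y)) : P.-integrable A (EFin \o Y).
  exact: (integrableS _ _ _ iY).
rewrite (_ : integral _ _ _ =
    \int[P]_(x in A) (X x)%:E - \int[P]_(x in A) (m x)%:E)%E.
  by rewrite mE// subee// (integrable_fin_num mA (iA _ iX)).
by apply: integralB_EFin => //; exact: iA.
Qed.

Lemma cond_nonpos_sqr_sub Y q v : measurable_fun setT Y -> 0 <= v ->
  is_cond_exp_nneg P G (fun x => (Y x ^+ 2)%:E) q ->
  {ae P, forall x, (q x <= v%:E)%E} -> cond_nonpos P G (fun x => Y x ^+ 2 - v).
Proof.
move=> mY v0 [Gq q0 qE] qv.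
have int_q_le A : measurable A ->
    (\int[P]_(x in A) q x <= \int[P]_(x in A) cst v%:E x)%E.
  move=> mA; apply: ae_ge0_le_integral => //.
  - exact: measurable_funS (G_measurable_fun Gm Gq).
  - by apply: filterS qv => x ? _.
have icst : P.-integrable setT (EFin \o cst v).
  exact: finite_measure_integrable_cst.
have iY2 : P.-integrable setT (EFin \o (fun x => Y x ^+ 2)).
  apply/integrableP; split; first exact/measurable_EFinP/measurable_funX.
  rewrite (eq_integral (fun x => (Y x ^+ 2)%:E)); last first.
    by move=> x _ /=; rewrite ger0_norm ?sqr_ge0.
  rewrite -(qE _ (sigma_algebra_setT sG)).
  apply: (le_lt_trans (int_q_le _ measurableT)).
  by rewrite -ge0_fin_numE ?integral_ge0// integrable_fin_num.
split=> [|A GA]; first exact: (integrableB measurableT iY2 icst).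
have mA := Gm GA.
rewrite (_ : integral _ _ _ =
    \int[P]_(x in A) (Y x ^+ 2)%:E - \int[P]_(x in A) cst v%:E x)%E.
  by rewrite sube_le0 -qE//; exact: int_q_le.
apply: integralB_EFin => //.
- exact: (integrableS _ _ _ iY2).
- exact: (integrableS _ _ _ icst).
Qed.

Lemma cond_nonpos_increment S S' m' : P.-integrable setT (EFin \o S) ->
  P.-integrable setT (EFin \o S') -> is_cond_exp P G S' m' ->
  {ae P, forall x, m' x <= S x} -> cond_nonpos P G (S' \- S).
Proof.
move=> iS iS' condS' m'S; have [_ im' _] := condS'.
rewrite (_ : S' \- S = (S' \- m') \+ (m' \- S)); last first.
  by apply/funext => x /=; rewrite subrKA.
apply: cond_nonposD => //; first exact: cond_nonpos_centred.
apply: ae_le0_cond_nonpos => //; first exact: (integrableB measurableT im' iS).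
by apply: filterS m'S => x; rewrite subr_le0.
Qed.

Lemma cond_nonpos_sqr_subM Y w v : 0 <= v -> G_measurable G w ->
    (forall x, 0 <= w x <= 1) -> cond_nonpos P G (fun x => Y x ^+ 2 - v) ->
  cond_nonpos P G (fun x => (w x * Y x) ^+ 2 - v).
Proof.
move=> v0 Gw w01 cY2.
have w2_01 x : 0 <= w x ^+ 2 <= 1.
  by have /andP[w0 w1] := w01 x; rewrite sqr_ge0 expr_le1.
have Gw2 : G_measurable G (fun x => w x ^+ 2).
  apply: (G_measurable_comp (g := fun s : R => s ^+ 2)) Gw.
  exact: exprn_measurable.
rewrite (_ : (fun x => _) = ((fun x => w x ^+ 2) \* (fun x => Y x ^+ 2 - v)) \+
    (fun x => (w x ^+ 2 - 1) * v)); last by apply/funext => x /=; ring.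
apply: cond_nonposD => //; first exact: cond_nonposM cY2.
have le0 x : (w x ^+ 2 - 1) * v <= 0.
  by have /andP[_ w1] := w2_01 x; rewrite mulr_le0_ge0// subr_le0.
apply: ae_le0_cond_nonpos => //; last by apply: aeW => x; exact: le0.
apply: (@integrable_bounded _ _ _ _ _ (- v) 0) => [|x].
  apply: measurable_funM => //; apply: measurable_funB => //.
  exact: G_measurable_fun Gw2.
rewrite le0 andbT.
by have /andP[w0 _] := w2_01 x; rewrite mulrBl mul1r lerDr mulr_ge0.
Qed.

Lemma supermartingale_dominated_step d v S S' m' m q : 0 < d -> 0 <= v ->
  P.-integrable setT (EFin \o S) -> P.-integrable setT (EFin \o S') ->
  is_cond_exp P G S' m' -> {ae P, forall x, m' x <= S x} ->
  {ae P, forall x, S' x - S x <= d} ->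
  is_cond_exp P G (fun x => S' x - S x) m ->
  is_cond_exp_nneg P G (fun x => ((S' x - S x - m x) ^+ 2)%:E) q ->
  {ae P, forall x, (q x <= v%:E)%E} -> dominated_step d v S S'.
Proof.
move=> d0 v0 iS iS' condS' m'S Xd condX condY qv.
pose X := S' \- S; pose Y := X \- m; have [Gm' im _] := condX.
have iX : P.-integrable setT (EFin \o X).
  exact: (integrableB measurableT iS' iS).
have cY : cond_nonpos P G Y by exact: cond_nonpos_centred.
have cY2 : cond_nonpos P G (fun x => Y x ^+ 2 - v).
  apply: cond_nonpos_sqr_sub condY qv => //.
  by apply/measurable_EFinP; have [/measurable_int] := cY.
have m0 : {ae P, forall x, m x <= 0}.
  apply: (cond_nonpos_ae_le0 Gm Gm'); apply: is_cond_exp_cond_nonpos condX _.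
  exact: cond_nonpos_increment condS' m'S.
have Gz : G_measurable G (shrink d \o m).
  exact: G_measurable_comp (measurable_shrink d0) Gm'.
have z01 x : 0 <= (shrink d \o m) x <= 1 by exact: shrink_itv.
exists ((shrink d \o m) \* Y); split.
- apply: filterS2 Xd m0 => x Xx mx; rewrite -lerBlDl.
  by have /andP[] := shrink_centred_bounds d0 mx Xx.
- apply: filterS2 Xd m0 => x Xx mx.
  by have /andP[] := shrink_centred_bounds d0 mx Xx.
- exact: cond_nonposM cY.
- exact: cond_nonpos_sqr_subM cY2.
Qed.

End dominated_step.

Section moment_integrals.
Context {R : realType} {dT : measure_display} {T : measurableType dT}.
Variable mu : {measure set T -> \bar R}.
Implicit Types (S X e : T -> R) (d t v y : R) (V : R -> R).

Lemma measurable_sqpos (f : T -> R) t : measurable_fun setT f ->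
  measurable_fun setT (fun x => (sqpos (f x - t))%:E).
Proof.
move=> mf; apply/measurable_EFinP/measurable_funX/measurable_maxr => //.
exact: measurable_funB.
Qed.

Lemma integral_two_point_le (F : T -> R -> R) V d v t : 0 <= v ->
    (forall x t, 0 <= F x t) ->
    (forall t, measurable_fun setT (fun x => (F x t)%:E)) ->
    (forall t, (\int[mu]_x (F x t)%:E <= (V t)%:E)%E) ->
  (\int[mu]_x (two_point d v (F x) t)%:E <= (two_point d v V t)%:E)%E.
Proof.
move=> v0 F0 mF FV; have p0 b : 0 <= Zprob d v b by exact: Zprob_ge0.
rewrite (eq_integral (fun x =>
  \sum_b (Zprob d v b)%:E * (F x (t - Zval d v b))%:E)%E); last first.
  by move=> x _; rewrite /two_point -sumEFin.
rewrite ge0_integral_sum//; last 2 first.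
- by move=> b; exact: measurable_funeM.
- by move=> b x _; rewrite -EFinM lee_fin mulr_ge0.
rewrite /two_point -sumEFin; apply: lee_sum => b _.
rewrite ge0_integralZl_EFin ?EFinM ?lee_wpmul2l ?lee_fin// => x _.
by rewrite lee_fin.
Qed.

Lemma integral_sqpos_le_sqr_line S S' X e d v t : 0 < d -> 0 <= v ->
    measurable_fun setT S' -> measurable_fun setT X -> measurable_fun setT e ->
    {ae mu, forall x, S' x <= S x + X x} -> {ae mu, forall x, X x <= d} ->
    (forall x, 0 <= e x) -> {ae mu, forall x, S x + d - t <= e x} ->
  (\int[mu]_x (sqpos (S' x - t))%:E <=
   \int[mu]_x ((intercept d v (e x) + slope d v (e x) * X x) ^+ 2)%:E)%E.
Proof.
move=> d0 v0 mS' mX me S'X Xd e0 Se; apply: ae_ge0_le_integral => //.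
- by move=> x _; rewrite lee_fin sqpos_ge0.
- exact: measurable_sqpos.
- by move=> x _; rewrite lee_fin sqr_ge0.
- apply/measurable_EFinP/measurable_funX/measurable_funD.
    exact: measurableT_comp (measurable_intercept d v) me.
  apply: measurable_funM => //.
  exact: measurableT_comp (measurable_slope d v) me.
apply: filterS3 S'X Xd Se => x S'x Xx Sx _; rewrite lee_fin.
apply: (@le_trans _ _ (sqpos (X x - (t - S x)))).
  by apply: ler_sqpos; lra.
by apply: sqpos_le_sqr_line => //; lra.
Qed.

Lemma integral_slope_two_point S e d v t : 0 < d -> 0 <= v ->
    measurable_fun setT S -> measurable_fun setT e ->
    {ae mu, forall x, e x = Num.max 0 (S x + d - t)} ->
  (\int[mu]_x (intercept d v (e x) ^+ 2 + slope d v (e x) ^+ 2 * v)%:E =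
   \int[mu]_x (two_point d v (fun t => sqpos (S x - t)) t)%:E)%E.
Proof.
move=> d0 v0 mS me eE; apply: ae_eq_integral => //.
- apply/measurable_EFinP/measurable_funD; last apply: measurable_funM => //.
    exact/measurable_funX/(measurableT_comp (measurable_intercept d v)).
  exact/measurable_funX/(measurableT_comp (measurable_slope d v)).
- apply/measurable_EFinP/measurable_sum => c; apply: measurable_funM => //.
  by apply/measurable_EFinP; exact: measurable_sqpos.
by apply: filterS eE => x -> _; rewrite slope_two_point.
Qed.

Lemma markov_sqpos S y t : measurable_fun setT S -> t < y ->
  (((y - t) ^+ 2)%:E * mu [set x | (y <= S x)%R] <=
   \int[mu]_x (sqpos (S x - t))%:E)%E.
Proof.
move=> mS ty; have yt0 : 0 < (y - t) ^+ 2 by rewrite exprn_gt0// subr_gt0.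
have := le_integral_abse mu measurableT (measurable_sqpos t mS) yt0.
rewrite setTI (_ : [set x | _] = [set x | y <= S x]); last first.
  apply/seteqP; split=> x /=; rewrite lee_fin ger0_norm ?sqpos_ge0//.
    rewrite leNgt [y <= _]leNgt; apply: contra => Sy.
    have [St|St] := leP (S x - t) 0; first by rewrite ler0_sqpos.
    by rewrite ger0_sqpos ?ltr_sqr ?nnegrE; lra.
  by move=> yS; rewrite ger0_sqpos ?ler_sqr ?nnegrE; lra.
by under eq_integral do rewrite /= ger0_norm ?sqpos_ge0//.
Qed.

End moment_integrals.

Section dominated_step_moment.
Context {R : realType} {dT : measure_display} {T : measurableType dT}.
Variable P : probability T R.
Implicit Types (G : set (set T)) (S X : T -> R) (d t v B K : R).

Lemma integral_sqr_affine_le dV (V : measurableType dV) G (s : T -> V) X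
    (b k : V -> R) B K v :
    sigma_algebra setT G -> G `<=` measurable -> G_measurable G s ->
    measurable_fun setT b -> measurable_fun setT k ->
    (forall x, 0 <= b (s x) <= B) -> (forall x, 0 <= k (s x) <= K) -> 0 <= v ->
    cond_nonpos P G X -> cond_nonpos P G (fun x => X x ^+ 2 - v) ->
  (\int[P]_x ((b (s x) + k (s x) * X x) ^+ 2)%:E <=
   \int[P]_x (b (s x) ^+ 2 + k (s x) ^+ 2 * v)%:E)%E.
Proof.
move=> sG Gm Gs mb mk bB kK v0 cX cX2; have ms := G_measurable_fun Gm Gs.
have weighted Y (f : V -> R) (M : R) : measurable_fun setT f ->
    (forall x, 0 <= f (s x) <= M) -> cond_nonpos P G Y ->
    cond_nonpos P G ((f \o s) \* Y).
  move=> mf fM; apply: (cond_nonposM sG Gm (G_measurable_comp mf Gs)) => x.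
  exact: fM.
have [b2B k2K bkM] : [/\ forall x, 0 <= b (s x) ^+ 2 <= B ^+ 2,
    forall x, 0 <= k (s x) ^+ 2 <= K ^+ 2 &
    forall x, 0 <= 2 * b (s x) * k (s x) <= 2 * B * K].
  split=> x; have /andP[b0 bM] := bB x; have /andP[k0 kM] := kK x.
  - by rewrite sqr_ge0 lerXn2r ?nnegrE ?(le_trans b0).
  - by rewrite sqr_ge0 lerXn2r ?nnegrE ?(le_trans k0).
  - by rewrite !mulr_ge0//= ler_pM ?mulr_ge0 ?ler_wpM2l.
pose error := ((fun y => 2 * b y * k y) \o s) \* X \+
  ((fun y => k y ^+ 2) \o s) \* (fun x => X x ^+ 2 - v).
have [ierror error_le0] : cond_nonpos P G error.
  apply: cond_nonposD => //; apply: weighted => //.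
    by do 2 apply: measurable_funM => //.
  exact: measurable_funX.
pose main x := b (s x) ^+ 2 + k (s x) ^+ 2 * v.
have imain : P.-integrable setT (EFin \o main).
  apply: (@integrable_bounded _ _ _ P main 0 (B ^+ 2 + K ^+ 2 * v)) => [|x].
    by apply: measurable_funD; [|apply: measurable_funM => //];
      apply: measurable_funX; exact: measurableT_comp ms.
  have /andP[b0 bM] := b2B x; have /andP[k0 kM] := k2K x.
  by apply/andP; split; [exact/addr_ge0/mulr_ge0|exact/lerD/ler_wpM2r].
rewrite (eq_integral (fun x => (main x)%:E + (error x)%:E)%E); last first.
  by move=> x _; rewrite -EFinD /main /error /=; congr _%:E; ring.
rewrite (integralD_EFin measurableT imain ierror).
by apply: geeDl; apply: error_le0; exact: sigma_algebra_setT.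
Qed.

(* Clipping the excess at the almost sure bound of S makes the weights
   bounded. *)
Lemma dominated_step_integral_sqpos G S S' d v B t :
    sigma_algebra setT G -> G `<=` measurable -> G_measurable G S ->
    measurable_fun setT S' -> 0 < d -> 0 <= v ->
    {ae P, forall x, S x <= B} -> dominated_step P G d v S S' ->
  (\int[P]_x (sqpos (S' x - t))%:E <=
   \int[P]_x (two_point d v (fun t => sqpos (S x - t)) t)%:E)%E.
Proof.
move=> sG Gm GS mS' d0 v0 SB [X [S'X Xd cX cX2]].
pose e := clipped_excess d t B \o S; pose C := Num.max 0 (B + d - t).
have e_itv x : 0 <= e x <= C by exact: clipped_excess_itv.
have e0 x : 0 <= e x by have /andP[] := e_itv x.
have eE : {ae P, forall x, e x = Num.max 0 (S x + d - t)}.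
  by apply: filterS SB => x; exact: clipped_excessE.
have Se : {ae P, forall x, S x + d - t <= e x}.
  by apply: filterS eE => x ->; rewrite le_max lexx orbT.
have Ge : G_measurable G e.
  exact: G_measurable_comp (measurable_clipped_excess d t B) GS.
have me := G_measurable_fun Gm Ge; have mS := G_measurable_fun Gm GS.
have mX : measurable_fun setT X.
  by have [/measurable_int/measurable_EFinP] := cX.
have b_itv x : 0 <= intercept d v (e x) <= C.
  have /andP[b0 be] := intercept_itv d0 v0 (e0 x).
  by have /andP[_ eC] := e_itv x; rewrite b0 (le_trans be).
have k_itv x : 0 <= slope d v (e x) <= 1 := slope_itv d0 v0 (e0 x).
rewrite -(integral_slope_two_point d0 v0 mS me eE).
apply: le_trans (integral_sqpos_le_sqr_line d0 v0 mS' mX me S'X Xd e0 Se) _.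
exact: integral_sqr_affine_le (measurable_intercept d v) (measurable_slope d v)
  b_itv k_itv v0 cX cX2.
Qed.

End dominated_step_moment.

Section dominated_process.
Context {R : realType} {dT : measure_display} {T : measurableType dT}.
Variables (P : probability T R) (H : nat -> set (set T)) (S : nat -> T -> R).
Variables (d : R) (v : nat -> R).
Hypotheses (sH : forall i, sigma_algebra setT (H i)).
Hypotheses (Hm : forall i, H i `<=` measurable).
Hypotheses (HS : forall i, G_measurable (H i) (S i)).
Hypotheses (d0 : 0 < d) (v0 : forall i, 0 <= v i).
Hypotheses (S0 : {ae P, forall x, S 0%N x <= 0}).
Hypotheses (stepS : forall i, dominated_step P (H i) d (v i) (S i) (S i.+1)).

Let mS i : measurable_fun setT (S i).
Proof. exact: G_measurable_fun (HS i). Qed.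

Lemma dominated_process_ae_le n : {ae P, forall x, S n x <= n%:R * d}.
Proof.
elim: n => [|n SB]; first by apply: filterS S0 => x; rewrite mul0r.
have [X [S'X Xd _ _]] := stepS n.
by apply: filterS3 SB S'X Xd => x Sx S'x Xx; rewrite -natr1 mulrDl mul1r; lra.
Qed.

Lemma dominated_process_integral_sqpos n t :
  (\int[P]_x (sqpos (S n x - t))%:E <=
   (two_points d (mkseq v n) sqneg t)%:E)%E.
Proof.
elim: n t => [|n IH] t.
  apply: (@le_trans _ _ (\int[P]_x (cst (sqpos (- t))%:E x))%E).
    apply: ae_ge0_le_integral => //.
    - by move=> x _; rewrite lee_fin sqpos_ge0.
    - exact: measurable_sqpos.
    - by move=> x _; rewrite lee_fin sqpos_ge0.
    - by apply: filterS S0 => x Sx _; rewrite lee_fin ler_sqpos// gerDr.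
  rewrite integral_cst// -[leRHS]mule1.
  by apply: lee_wpmul2l; [rewrite lee_fin sqpos_ge0|exact: probability_le1].
rewrite mkseqS (@perm_two_points _ _ _ (v n :: mkseq v n)) ?perm_rcons//.
apply: le_trans (dominated_step_integral_sqpos _ _ _ (HS n) _ _ _
  (dominated_process_ae_le n) (stepS n)) _ => //.
apply: integral_two_point_le => // [x s|s]; first exact: sqpos_ge0.
exact: measurable_sqpos.
Qed.

Lemma dominated_process_tail_le n w y t :
    \sum_(i < n) v i = n%:R * w -> t < y ->
  (((y - t) ^+ 2)%:E * P [set x | (y <= S n x)%R] <=
   (Texpect n d w (fun s => sqpos (s - t)))%:E)%E.
Proof.
move=> sum_v ty; apply: le_trans (markov_sqpos P (mS n) ty) _.
apply: le_trans (dominated_process_integral_sqpos n t) _.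
rewrite lee_fin -[n in Texpect n](size_mkseq v n).
apply: two_points_le_Texpect => //.
  by apply/allP => _ /mapP[i _ ->]; exact: v0.
by rewrite size_mkseq -sum_v big_map -val_enum_ord big_map big_enum.
Qed.

End dominated_process.

(** * Smoothing by a uniform variable *)

Section derivatives.
Context {R : realType}.
Implicit Types (f g : R -> R) (b c l s t x : R).

Lemma ge0_is_derive_ndecr f f' : (forall x, is_derive x 1 f (f' x)) ->
  (forall x, 0 <= f' x) -> {homo f : x y / x <= y}.
Proof.
move=> df f'0 x y xy.
have cf : {within `[x, y], continuous f}.
  by apply: derivable_within_continuous => z _; have [] := df z.
have [c _ fE] := MVT_segment xy (fun z _ => df z) cf.
by rewrite -subr_ge0 fE mulr_ge0// subr_ge0.
Qed.

Lemma ge0_is_derive2_ge0 f f' f'' M : (forall x, is_derive x 1 f (f' x)) ->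
  (forall x, is_derive x 1 f' (f'' x)) -> (forall x, 0 <= f'' x) ->
  (forall x, M <= x -> f' x <= 0) -> (forall x, M <= x -> 0 <= f x) ->
  forall x, 0 <= f x.
Proof.
move=> df df' f''0 f'_far f_far x.
have M_le y : M <= Num.max y M by rewrite le_max lexx orbT.
have le_max_M y : y <= Num.max y M by rewrite le_max lexx.
have f'0 y : f' y <= 0.
  apply: le_trans (f'_far _ (M_le y)).
  exact: (ge0_is_derive_ndecr df' f''0).
apply: le_trans (f_far _ (M_le x)) _; rewrite -lerN2.
apply: (@ge0_is_derive_ndecr (- f) (- f')) => // y; rewrite oppr_ge0.
exact: f'0.
Qed.

Lemma is_derive_maxX (k : nat) x :
  is_derive x 1 (fun y : R => Num.max y 0 ^+ k.+2)
    (k.+2%:R * Num.max x 0 ^+ k.+1).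
Proof.
have [x0|x0|->] := ltgtP x 0.
- rewrite expr0n /= mulr0.
  apply: (near_eq_is_derive _ (is_derive_cst (0 : R) x 1)).
  near=> y; have y0 : y <= 0 by apply: ltW; near: y; exact: lt_nbhsl.
  by rewrite /= (max_idPr y0) expr0n.
- have dX := @is_deriveX R R id k.+2 x 1 1 (is_derive_id x 1).
  rewrite exprfctE /GRing.scale /= mulr1 in dX; apply: (near_eq_is_derive _ dX).
  near=> y; have y0 : 0 <= y by apply: ltW; near: y; exact: lt_nbhsr.
  by rewrite (max_idPl y0).
- rewrite expr0n /= mulr0; apply/is_derive1_caratheodory.
  exists (fun z => Num.max z 0 ^+ k.+1); split.
  + move=> z; rewrite maxxx expr0n /= !subr0.
    have [z0|z0] := leP z 0; first by rewrite !expr0n /= mul0r.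
    by rewrite exprSr.
  + apply: (@continuous_comp _ _ _ (fun z : R => Num.max z 0)
        (fun z => z ^+ k.+1)).
      by apply: continuous_max => //; first [exact: cvg_id|exact: cvg_cst].
    exact: exprn_continuous.
  + by rewrite maxxx expr0n.
Unshelve. all: by end_near. Qed.

Lemma is_derive_comp_shift f b c x : is_derive (x + c) 1 f b ->
  is_derive x 1 (fun y => f (y + c)) b.
Proof.
move=> df; have := @is_derive1_comp R f (fun y => y + c) x b 1 df.
by rewrite mulr1; apply; exact: is_derive_shift.
Qed.

Lemma is_derive_expR_scale c l x :
  is_derive x 1 (fun t => c * expR (- l * t)) (- l * (c * expR (- l * x))).
Proof.
have dl : is_derive x 1 (fun t => - l * t) (- l).
  by have := is_deriveZ (- l) (is_derive_id x 1); rewrite /GRing.scale /= mulr1.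
have := is_deriveZ c (is_derive1_comp (is_derive_expR (- l * x)) dl).
by rewrite /GRing.scale /= => dexp; apply: is_derive_eq dexp _; ring.
Qed.

Lemma is_derive_weighted_sum (I : finType) (p s : I -> R) f f' x :
  (forall y : R, is_derive y 1 f (f' y)) ->
  is_derive x 1 (fun t => \sum_i p i * f (s i - t))
    (- \sum_i p i * f' (s i - x)).
Proof.
move=> df; rewrite -sumrN.
rewrite (_ : (fun t => _) = \sum_i (fun t => p i * f (s i - t))); last first.
  by apply/funext => t; rewrite fct_sumE.
elim/big_ind2 : _ => [|g g' h h'|i _].
- exact: is_derive_cst.
- exact: is_deriveD.
have dsub : is_derive x 1 (fun t => s i - t) (- 1).
  rewrite -[- 1]add0r.
  exact: (is_deriveB (is_derive_cst (s i) x 1) (is_derive_id x 1)).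
have := is_deriveZ (p i)
  (@is_derive1_comp R f (fun t => s i - t) x _ _ (df _) dsub).
by rewrite /GRing.scale /= mulrN1 mulrN.
Qed.

End derivatives.

Section uniform_smoothing.
Context {R : realType}.
Implicit Types (a h l s t x A : R) (k : nat).

(* This is E (x + U)_+^k for U uniform on [-a, a]; for k = 0, P(x + U >= 0). *)
Definition unif_moment a k x :=
  (Num.max (x + a) 0 ^+ k.+1 - Num.max (x - a) 0 ^+ k.+1) / (2 * a * k.+1%:R).

Lemma unif_moment_eq0 a k x : 0 < a -> x <= - a -> unif_moment a k x = 0.
Proof.
move=> a0 xa; rewrite /unif_moment !max_r; try lra.
by rewrite subrr mul0r.
Qed.

Lemma unif_moment0_ge0 a x : 0 < a -> 0 <= unif_moment a 0 x.
Proof.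
move=> a0; rewrite divr_ge0 ?mulr_ge0 ?(ltW a0)// subr_ge0 le_max2//.
by rewrite lerD2l; lra.
Qed.

Lemma unif_moment0_gt0 a x : 0 < a -> - a < x -> 0 < unif_moment a 0 x.
Proof.
move=> a0 ax; rewrite divr_gt0 ?mulr_gt0// !expr1.
rewrite (@max_l _ _ (x + a)); last lra.
by have [?|?] := leP (x - a) 0; lra.
Qed.

Lemma unif_moment0_eq1 a x : 0 < a -> a <= x -> unif_moment a 0 x = 1.
Proof.
by move=> a0 ax; rewrite /unif_moment !expr1 !max_l; [field|..]; lra.
Qed.

Lemma unif_moment0_le1 a x : 0 < a -> unif_moment a 0 x <= 1.
Proof.
move=> a0; rewrite ler_pdivrMr ?mulr_gt0// !expr1 mulr1 mul1r.
by have [?|?] := leP (x + a) 0; have [?|?] := leP (x - a) 0; lra.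
Qed.

Lemma is_derive_unif_moment a k x : 0 < a ->
  is_derive x 1 (unif_moment a k.+1) (k.+1%:R * unif_moment a k x).
Proof.
move=> a0; have dM c := is_derive_comp_shift (is_derive_maxX k (x + c)).
have := is_deriveZ (2 * a * k.+2%:R)^-1 (is_deriveB (dM a) (dM (- a))).
rewrite /GRing.scale /= => dU.
rewrite (_ : unif_moment a k.+1 = (fun y : R => (2 * a * k.+2%:R)^-1 *
  (Num.max (y + a) 0 ^+ k.+2 - Num.max (y - a) 0 ^+ k.+2))); last first.
  by apply/funext => y; rewrite mulrC.
apply: is_derive_eq dU _; rewrite /unif_moment.
have k0 : 0 <= k%:R :> R by [].
by field; apply/and3P; split; lra.
Qed.

(* This is Jensen's inequality. *)
Lemma sqpos_le_unif_moment a s : 0 < a -> sqpos s <= unif_moment a 2 s.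
Proof.
move=> a0; rewrite ler_pdivlMr ?mulr_gt0//.
have [s0|s0] := leP s 0.
  rewrite ler0_sqpos// mul0r (@max_r _ _ (s - a)); last lra.
  by rewrite expr0n subr0 exprn_ge0// le_max lexx orbT.
rewrite (ger0_sqpos (ltW s0)) (@max_l _ _ (s + a)); last lra.
have [sa|sa] := leP (s - a) 0; rewrite -subr_ge0.
  have -> : (s + a) ^+ 3 - 0 ^+ 3 - s ^+ 2 * (2 * a * 3) =
    s ^+ 3 + a ^+ 3 + 3 * (a * s) * (a - s) by rewrite expr0n /=; ring.
  by rewrite !addr_ge0 ?mulr_ge0 ?exprn_ge0//; lra.
have -> : (s + a) ^+ 3 - (s - a) ^+ 3 - s ^+ 2 * (2 * a * 3) = a ^+ 3 *+ 2.
  by ring.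
by rewrite mulrn_wge0// exprn_ge0// ltW.
Qed.

(* Twice the left-hand side of the hypothesis is the second derivative of the
   left-hand side of the conclusion. *)
Lemma weighted_unif_moment_le_expR (I : finType) (p s : I -> R) a A l t :
    0 < a -> 0 < l -> (forall i, 0 <= p i) ->
    (forall x, \sum_i p i * unif_moment a 0 (s i - x) <= A * expR (- l * x)) ->
  \sum_i p i * unif_moment a 2 (s i - t) <= 2 * A / l ^+ 2 * expR (- l * t).
Proof.
move=> a0 l0 p0 tail_le; have l_neq0 : l != 0 by rewrite gt_eqF.
pose U k x := \sum_i p i * unif_moment a k (s i - x).
have dU k x : is_derive x 1 (U k.+1) (- (k.+1%:R * U k x)).
  rewrite mulr_sumr; under eq_bigr do rewrite mulrCA.
  exact: (is_derive_weighted_sum p s x (fun y => is_derive_unif_moment k y a0)).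
have U_far k x : a + \sum_i `|s i| <= x -> U k x = 0.
  move=> x_far; rewrite /U big1// => i _; rewrite unif_moment_eq0 ?mulr0//.
  suff : s i <= \sum_i `|s i| by lra.
  by apply: le_trans (ler_norm _) _; rewrite (bigD1 i)//= lerDl sumr_ge0.
have A0 : 0 <= A.
  have := tail_le 0; rewrite mulr0 expR0 mulr1; apply: le_trans.
  by apply: sumr_ge0 => i _; rewrite mulr_ge0 ?unif_moment0_ge0.
pose E c x := c * expR (- l * x).
have E_ge0 c x : 0 <= c -> 0 <= E c x by move=> c0; rewrite mulr_ge0 ?expR_ge0.
rewrite -subr_ge0; move: t.
apply: (@ge0_is_derive2_ge0 _ (fun x => E (2 * A / l ^+ 2) x - U 2%N x)
  (fun x => - E (2 * A / l) x + 2 * U 1%N x) (fun x => 2 * (E A x - U 0%N x))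
  (a + \sum_i `|s i|)) => x.
- apply: (is_derive_eq (f' := - l * E (2 * A / l ^+ 2) x - - (2 * U 1%N x))).
    by apply: is_deriveB; exact: is_derive_expR_scale.
  by rewrite /E; field.
- apply: (is_derive_eq (f' := - (- l * E (2 * A / l) x) + 2 * - (1 * U 0%N x))).
    have dE := is_derive_expR_scale (2 * A / l) l x.
    exact: (is_deriveD (is_deriveN dE) (is_deriveZ 2 (dU 0%N x))).
  by rewrite /E; field.
- by rewrite mulr_ge0// subr_ge0; exact: tail_le.
- move=> /U_far ->; rewrite mulr0 addr0 oppr_le0 E_ge0//.
  by rewrite divr_ge0 ?mulr_ge0// ltW.
- by move=> /U_far ->; rewrite subr0 E_ge0// divr_ge0 ?sqr_ge0// mulr_ge0.
Qed.

Lemma weighted_sqpos_le_expR (I : finType) (p s : I -> R) a A l t :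
    0 < a -> 0 < l -> (forall i, 0 <= p i) ->
    (forall x, \sum_i p i * unif_moment a 0 (s i - x) <= A * expR (- l * x)) ->
  \sum_i p i * sqpos (s i - t) <= 2 * A / l ^+ 2 * expR (- l * t).
Proof.
move=> a0 l0 p0 tail_le.
apply: le_trans (weighted_unif_moment_le_expR t a0 l0 p0 tail_le).
by apply: ler_sum => i _; rewrite ler_wpM2l ?sqpos_le_unif_moment.
Qed.

Lemma interpolated_indicator h x (m : int) : 0 < h ->
  let k : int := Num.floor (x / h) in let gam := (x - k%:~R * h) / h in
  (1 - gam) * (k <= m)%R%:R + gam * (k + 1 <= m)%R%:R =
  unif_moment (h / 2) 0 (m%:~R * h + h / 2 - x).
Proof.
move=> h0 k gam; have hn0 : h != 0 by rewrite gt_eqF.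
have xhE : x / h = k%:~R + gam by rewrite /gam; field.
have [g0 g1] : 0 <= gam /\ gam < 1.
  have := floor_le (x / h); have := floorD1_gt (x / h).
  by rewrite -/k xhE intrD; lra.
have xE : x = (k%:~R + gam) * h by rewrite -xhE divfK.
have h20 : 0 < h / 2 by lra.
rewrite xE; have [km|mk|mE] := ltgtP k m.
- rewrite lezD1 km unif_moment0_eq1//=; first by ring.
  have : (k + 1)%:~R <= m%:~R :> R by rewrite ler_int lezD1.
  by rewrite intrD; nra.
- rewrite lezD1 (ltNge k m) (ltW mk) unif_moment_eq0//=; first by ring.
  have : (m + 1)%:~R <= k%:~R :> R by rewrite ler_int lezD1.
  by rewrite intrD; nra.
- rewrite mE lezD1 ltxx /= /unif_moment !expr1 max_l; last by nra.
  by rewrite max_r; [field|nra].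
Qed.

End uniform_smoothing.

(** * Log-concave majorants of the binomial tail *)

Section log_concavity.
Context {R : realType}.
Implicit Types (f g : R -> R) (b c p t x y z : R).

Lemma log_concave_cst c : 0 < c -> log_concave (fun=> c).
Proof.
move=> c0; split=> [_|_ _ t _]; first exact: ltW.
by rewrite /lnE gt_eqF// -!EFinM -EFinD lee_fin -mulrDl addrC subrK mul1r.
Qed.

Lemma log_concave_ln_le g x y t : log_concave g -> 0 <= t <= 1 ->
    0 < g x -> 0 < g y -> 0 < g (t * x + (1 - t) * y) ->
  t * ln (g x) + (1 - t) * ln (g y) <= ln (g (t * x + (1 - t) * y)).
Proof.
move=> [_ lc] t01 gx gy gz; have := lc x y t t01.
by rewrite /lnE !gt_eqF// -!EFinM -EFinD lee_fin.
Qed.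

Lemma log_concave_slopes_le g x y z : log_concave g -> x < y -> y < z ->
    0 < g x -> 0 < g y -> 0 < g z ->
  (ln (g z) - ln (g y)) / (z - y) <= (ln (g y) - ln (g x)) / (y - x).
Proof.
move=> lc xy yz gx gy gz; have zx : 0 < z - x by lra.
pose t := (z - y) / (z - x).
have t01 : 0 <= t <= 1 by rewrite divr_ge0 ?ler_pdivrMr//=; lra.
have yE : t * x + (1 - t) * z = y by rewrite /t; field; lra.
have := log_concave_ln_le lc t01 gx gz; rewrite yE => /(_ gy).
rewrite -(ler_pM2r zx) (_ : _ * (z - x) =
  (z - y) * ln (g x) + (y - x) * ln (g z)); last by rewrite /t; field; lra.
move=> chord; rewrite ler_pdivrMr ?subr_gt0// [leRHS]mulrAC.
by rewrite ler_pdivlMr ?subr_gt0//; lra.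
Qed.

Lemma log_concave_le_expR g y b : log_concave g -> y < b ->
    (forall x, x < b -> 0 < g x) ->
  exists l, forall x, x < b -> g x <= g y * expR (- l * (x - y)).
Proof.
move=> lc yb g0.
pose slopes := [set (ln (g z) - ln (g y)) / (z - y) | z in [set z | y < z < b]].
have slopes_le x : x < y -> ubound slopes ((ln (g y) - ln (g x)) / (y - x)).
  move=> xy _ [z /= /andP[yz zb] <-].
  by apply: log_concave_slopes_le => //; apply: g0; lra.
have sup_slopes : has_sup slopes.
  split; last first.
    exists ((ln (g y) - ln (g (y - 1))) / (y - (y - 1))).
    by apply: slopes_le; lra.
  pose z := (y + b) / 2.
  by exists ((ln (g z) - ln (g y)) / (z - y)), z => //=; rewrite /z; lra.
exists (- sup slopes) => x xb; rewrite opprK.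
rewrite -[g y]lnK ?posrE ?g0// -expRD -[leLHS]lnK ?posrE ?g0// ler_expR.
have [xy|yx|->] := ltgtP x y; last by rewrite subrr mulr0 addr0.
- have := ge_sup sup_slopes.1 (slopes_le x xy).
  by rewrite ler_pdivlMr ?subr_gt0//; lra.
- have : (ln (g x) - ln (g y)) / (x - y) <= sup slopes.
    by apply: (ub_le_sup sup_slopes.2); exists x => //=; rewrite yx xb.
  by rewrite ler_pdivrMr ?subr_gt0//; lra.
Qed.

Lemma le_least_logconcave_majorant f c p y : 0 < c ->
    (exists2 g, log_concave g & forall x, f x <= g x) ->
    (forall g, log_concave g -> (forall x, f x <= g x) -> p <= c * g y) ->
  p <= c * least_logconcave_majorant f y.
Proof.
move=> c0 [g lcg fg] p_le; rewrite mulrC -ler_pdivrMr//; apply: lb_le_inf.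
  by exists (g y), g.
by move=> _ [g' [lcg' fg'] <-]; rewrite ler_pdivrMr// mulrC p_le.
Qed.

End log_concavity.

Section tail_comparison.
Context {R : realType}.
Variables (n : nat) (d v : R).
Hypotheses (d0 : 0 < d) (v0 : 0 < v).
Implicit Types (g : R -> R) (A l p t x y : R).

Local Notation h := (d + v / d).

Lemma lattice_step_gt0 : 0 < h.
Proof. by rewrite addr_gt0// divr_gt0. Qed.

Lemma Tval_lattice (z : {ffun 'I_n -> bool}) :
  Tval d v z = n%:R * d - (\sum_(i < n) ~~ z i)%N%:R * h.
Proof.
have d_neq0 : d != 0 by rewrite gt_eqF.
rewrite natr_sum mulr_suml -[n in n%:R]card_ord -sum1_card natr_sum.
rewrite mulr_suml -sumrB; apply: eq_bigr => i _.
by rewrite /Zval; case: (z i) => /=; rewrite ?mul0r ?mul1r ?subr0//; ring.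
Qed.

Lemma Tval_itv (z : {ffun 'I_n -> bool}) :
  n%:R * (d - h) <= Tval d v z <= n%:R * d.
Proof.
have h0 := ltW lattice_step_gt0; rewrite Tval_lattice.
apply/andP; split; last by rewrite gerBl mulr_ge0.
rewrite mulrBr lerD2l lerN2 ler_wpM2r// ler_nat.
by rewrite -[leqRHS]card_ord -sum1_card; apply: leq_sum => i _; exact: leq_b1.
Qed.

Lemma TtailLin_unif_moment x :
  TtailLin n d v h x =
  Texpect n d v (fun s => unif_moment (h / 2) 0 (s + h / 2 - x)).
Proof.
rewrite /TtailLin /Ttail; set k := Num.floor _; set gam := (_ / h).
rewrite 2!(big_mkcond (fun z : {ffun 'I_n -> bool} => _ <= _)).
rewrite !mulr_sumr -big_split /=.
apply: eq_bigr => z _; rewrite -/(Tval d v z) -/(Tprob d v z).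
have TvalE := Tval_lattice z; set c := (\sum_(i < n) _)%N in TvalE.
have lattice_le (m : int) :
    (n%:R * d + m%:~R * h <= Tval d v z) = (m <= - c%:Z).
  rewrite TvalE lerD2l -mulNr ler_pM2r ?lattice_step_gt0//.
  by rewrite -(ler_int R) mulrNz.
have -> : Tval d v z + h / 2 - x = (- c%:Z)%:~R * h + h / 2 - (x - n%:R * d).
  by rewrite TvalE mulrNz; ring.
rewrite -interpolated_indicator ?lattice_step_gt0// !lattice_le -/k -/gam.
rewrite mulrDr; congr (_ + _).
  by case: ifP => _; rewrite ?mulr1 ?mulr0// mulrC.
by case: ifP => _; rewrite ?mulr1 ?mulr0// mulrC.
Qed.

Lemma TtailLin_le1 x : TtailLin n d v h x <= 1.
Proof.
rewrite TtailLin_unif_moment -[leRHS](@Texpect_cst _ n d v)//.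
apply: Texpect_le => // s.
by rewrite unif_moment0_le1// divr_gt0 ?lattice_step_gt0.
Qed.

Lemma TtailLin_eq1 x : x <= n%:R * (d - h) -> TtailLin n d v h x = 1.
Proof.
move=> x_low; rewrite TtailLin_unif_moment -[RHS](@Texpect_cst _ n d v)//.
apply: eq_bigr => z _; congr (_ * _); have /andP[Tval_ge _] := Tval_itv z.
by rewrite unif_moment0_eq1 ?divr_gt0 ?lattice_step_gt0//; lra.
Qed.

Lemma TtailLin_eq0 x : n%:R * d + h <= x -> TtailLin n d v h x = 0.
Proof.
move=> x_high; rewrite TtailLin_unif_moment; apply: big1 => z _.
have /andP[_ Tval_le] := Tval_itv z.
by rewrite unif_moment_eq0 ?mulr0 ?divr_gt0 ?lattice_step_gt0//; lra.
Qed.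

Lemma TtailLin_gt0 x : x < n%:R * d + h -> 0 < TtailLin n d v h x.
Proof.
move=> x_high; have h20 : 0 < h / 2 by rewrite divr_gt0 ?lattice_step_gt0.
rewrite TtailLin_unif_moment /Texpect (bigD1 [ffun=> true])//= ltr_wpDr//.
  apply: sumr_ge0 => z _.
  by rewrite mulr_ge0 ?unif_moment0_ge0// ltW// Tprob_gt0.
rewrite mulr_gt0 ?Tprob_gt0// unif_moment0_gt0//.
rewrite Tval_lattice big1; last by move=> i _; rewrite ffunE.
by rewrite mul0r subr0; lra.
Qed.

Lemma TtailLin_le_expR g y : log_concave g ->
    (forall x, TtailLin n d v h x <= g x) -> y < n%:R * d + h ->
  exists l, forall x, TtailLin n d v h x <= g y * expR (- l * (x - y)).
Proof.
move=> lcg tail_le y_lt; have [g_ge0 _] := lcg.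
have [|l g_le] := log_concave_le_expR lcg y_lt.
  by move=> x x_lt; apply: lt_le_trans (tail_le x); exact: TtailLin_gt0.
exists l => x; have [x_high|x_lt] := leP (n%:R * d + h) x; last first.
  exact: le_trans (tail_le x) (g_le x x_lt).
by rewrite TtailLin_eq0// mulr_ge0 ?expR_ge0.
Qed.

Lemma TtailLin_le_expR_ge1 A l y : l <= 0 -> 0 <= A ->
  (forall x, TtailLin n d v h x <= A * expR (- l * (x - y))) -> 1 <= A.
Proof.
move=> l0 A0 tail_le; pose x := Num.min (n%:R * (d - h)) y.
have := tail_le x; rewrite TtailLin_eq1 ?ge_min ?lexx// => /le_trans; apply.
rewrite ler_piMr// -expR0 ler_expR mulr_ge0_le0 ?oppr_ge0//.
by rewrite subr_le0 ge_min lexx orbT.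
Qed.

(* The hypothesis bounds the tail of T_n + U, for U uniform on [-h/2, h/2]. *)
Lemma Texpect_sqpos_le_expR A l t : 0 < l ->
    (forall x, TtailLin n d v h (x + h / 2) <= A * expR (- l * x)) ->
  Texpect n d v (fun s => sqpos (s - t)) <= 2 * A / l ^+ 2 * expR (- l * t).
Proof.
move=> l0 tail_le; have h20 : 0 < h / 2 by rewrite divr_gt0 ?lattice_step_gt0.
apply: (weighted_sqpos_le_expR t h20 l0) => [z|x].
  by rewrite ltW// Tprob_gt0.
apply: le_trans (tail_le x); rewrite TtailLin_unif_moment.
apply: ler_sum => z _.
by rewrite (_ : Tval d v z + h / 2 - (x + h / 2) = Tval d v z - x)//; ring.
Qed.

Lemma Texpect_sqpos_eq0 t : n%:R * d <= t ->
  Texpect n d v (fun s => sqpos (s - t)) = 0.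
Proof.
move=> t_ge; apply: big1 => z _; have /andP[_ Tval_le] := Tval_itv z.
by rewrite ler0_sqpos ?mulr0//; lra.
Qed.

(* The moment bound is applied at t = y - 2 / l, which minimises the resulting
   bound on p. *)
Lemma sqpos_tail_le_log_concave g p y : log_concave g ->
    (forall x, TtailLin n d v h x <= g x) -> p <= 1 ->
    (forall t, t < y ->
      (y - t) ^+ 2 * p <= Texpect n d v (fun s => sqpos (s - t))) ->
  p <= expR 2 / 2 * g (y + h / 2).
Proof.
move=> lcg tail_le p1 moment_le; have [g_ge0 _] := lcg.
have h0 := lattice_step_gt0.
have [y_le|y_gt] := leP y (n%:R * d); last first.
  have := moment_le _ y_gt; rewrite Texpect_sqpos_eq0// pmulr_rle0.
    by move/le_trans; apply; rewrite mulr_ge0 ?divr_ge0 ?expR_ge0.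
  by rewrite exprn_gt0 ?subr_gt0.
have y0_lt : y + h / 2 < n%:R * d + h by lra.
have [l exp_le] := TtailLin_le_expR lcg tail_le y0_lt.
set G := g (y + h / 2) in exp_le *.
have [l0|l0] := leP l 0.
  have G1 : 1 <= G := TtailLin_le_expR_ge1 l0 (g_ge0 _) exp_le.
  have e2 : 2 <= expR 2 :> R by have := expR_ge1Dx (2 : R); lra.
  by rewrite (le_trans p1)// -[1]mulr1 ler_pM// ler_pdivlMr ?mul1r.
have l_neq0 : l != 0 by rewrite gt_eqF.
pose t := y - 2 / l; have ty : t < y by rewrite ltrBlDr ltrDl divr_gt0.
have := le_trans (moment_le t ty)
  (@Texpect_sqpos_le_expR (G * expR (l * y)) l t l0 _).
have -> : 2 * (G * expR (l * y)) / l ^+ 2 * expR (- l * t) =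
    (2 / l) ^+ 2 * (expR 2 / 2 * G).
  have -> : expR 2 = expR (l * y) * expR (- l * t) :> R.
    by rewrite -expRD /t; congr expR; field.
  by field.
rewrite /t subKr ler_pM2l ?exprn_gt0 ?divr_gt0//; apply=> x.
apply: le_trans (exp_le _) _; rewrite -mulrA -expRD.
by rewrite (_ : - l * (x + h / 2 - (y + h / 2)) = l * y + - l * x)//; ring.
Qed.

End tail_comparison.

Theorem theorem2p3 (R : realType) (dT : measure_display) (T : measurableType dT)
  (P : probability T R) (H : nat -> set (set T)) (S : nat -> T -> R)
  (d : R) (sigma : nat -> R) (n : nat) :
  (* filtration of sub-sigma-algebras *)
  (forall i, sigma_algebra setT (H i)) ->
  (forall i, H i `<=` measurable) ->
  (forall i, H i `<=` H i.+1) ->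
  (* (S_i) is an integrable adapted supermartingale *)
  (forall i, G_measurable (H i) (S i)) ->
  (forall i, P.-integrable setT (EFin \o S i)) ->
  (forall i, exists m, is_cond_exp P (H i) (S i.+1) m /\
                       {ae P, forall x, m x <= S i x}) ->
  {ae P, forall x, S 0%N x <= 0} ->
  0 < d ->
  (forall i, (0 < i)%N -> 0 < sigma i) ->
  (* X_{i+1} := S_{i+1} - S_i <= d a.s. *)
  (forall i, {ae P, forall x, S i.+1 x - S i x <= d}) ->
  (* Var(X_{i+1} | H_i) <= sigma_{i+1}^2 a.s. *)
  (forall i, exists m, is_cond_exp P (H i) (fun x => S i.+1 x - S i x) m /\
     exists q, is_cond_exp_nneg P (H i)
                 (fun x => ((S i.+1 x - S i x - m x) ^+ 2)%:E) q /\
               {ae P, forall x, (q x <= (sigma i.+1 ^+ 2)%:E)%E}) ->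
  (1 <= n)%N ->
  let s2 := (\sum_(1 <= i < n.+1) sigma i ^+ 2) / n%:R in
  let h := d + s2 / d in
  forall y : R,
    (P [set x | (y <= S n x)%R] <=
       ((expR 2 / 2) * TtailLinLC n d s2 h (y + h / 2))%:E)%E.
Proof.
move=> sH Hm _ HS iS supS S0 d0 s0 Xd varX n1 s2 h y.
have s20 : 0 < s2.
  rewrite divr_gt0 ?ltr0n// big_nat_recl//= ltr_wpDr ?exprn_gt0 ?s0//.
  by apply: sumr_ge0 => i _; exact: sqr_ge0.
have sum_sigma : \sum_(i < n) sigma i.+1 ^+ 2 = n%:R * s2.
  by rewrite /s2 mulrC divfK ?pnatr_eq0 -?lt0n// big_add1 big_mkord.
have stepS i : dominated_step P (H i) d (sigma i.+1 ^+ 2) (S i) (S i.+1).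
  have [m [condX [q [condY qv]]]] := varX i; have [m' [condS m'S]] := supS i.
  by apply: supermartingale_dominated_step condS m'S (Xd i) condX condY qv;
    rewrite ?sqr_ge0.
have sigma2_ge0 i : 0 <= sigma i.+1 ^+ 2 by exact: sqr_ge0.
have tail_le :=
  dominated_process_tail_le sH Hm HS d0 sigma2_ge0 S0 stepS sum_sigma.
have mA : measurable [set x | y <= S n x].
  exact: Hm (G_measurable_ge y (HS n)).
rewrite -(fineK (fin_num_measure P _ mA)) lee_fin.
apply: le_least_logconcave_majorant => [||g lcg g_ge].
- by rewrite divr_gt0 ?expR_gt0.
- by exists (fun=> 1); [exact: log_concave_cst|exact: TtailLin_le1].
apply: (sqpos_tail_le_log_concave d0 s20 lcg g_ge) => [|t ty].
  by rewrite -lee_fin fineK ?fin_num_measure// probability_le1.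
by rewrite -lee_fin EFinM fineK ?fin_num_measure ?tail_le.
Qed.
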